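(* Let $\theta=1$. For each $n$, let $\mathbf{X}=(X_1,\dots,X_n)^\top$ follow the Curie--Weiss model $\mathbb{P}_{\theta,\boldsymbol{\mu}}$, let $\bar X=\frac1n\sum_{i=1}^n X_i$, and consider testing $H_0:\boldsymbol{\mu}=\mathbf{0}$ versus $H_1:\boldsymbol{\mu}\in\Xi(s,B)$, where $s=s_n$ and $B=B_n$ may depend on $n$. (i) If $s\tanh(B)\gg n^{1/4}$, then there is a suitably chosen diverging sequence $L_n\to\infty$ such that the test that rejects $H_0$ if and only if $n^{1/4}\bar X\ge L_n$ is asymptotically powerful. (ii) Conversely, if $s\tanh(B)=O(n^{1/4})$, then there is no asymptotically powerful test for this testing problem.
   Context: The Curie--Weiss model with parameters $\theta\in\mathbb{R}$ and $\boldsymbol{\mu}=(\mu_1,\dots,\mu_n)^\top\in\mathbb{R}^n$ is the probability distribution on $\{\pm1\}^n$ given by $$\mathbb{P}_{\theta,\boldsymbol{\mu}}(\mathbf{X}=\mathbf{x})=\frac{1}{Z(\theta,\boldsymbol{\mu})}\exp\Big(\frac{\theta}{n}\sum_{1\le i<j\le n}x_ix_j+\sum_{i=1}^n\mu_ix_i\Big),\qquad \mathbf{x}\in\{\pm1\}^n,$$ where $Z(\theta,\boldsymbol{\mu})$ is the normalizing constant. For $s\in\{1,\dots,n\}$ and $B>0$, $$\Xi(s,B)=\Big\{\boldsymbol{\mu}\in\mathbb{R}^n: |\mathrm{supp}(\boldsymbol{\mu})|=s,\ \min_{i\in\mathrm{supp}(\boldsymbol{\mu})}\mu_i\ge B\Big\},\qquad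 \mathrm{supp}(\boldsymbol{\mu})=\{1\le i\le n:\mu_i\neq0\}.$$ A test is a function $T:\{\pm1\}^n\to\{0,1\}$, where the value $1$ means rejecting $H_0$. Its worst-case risk is $$\mathrm{Risk}(T)=\mathbb{P}_{\theta,\mathbf{0}}(T(\mathbf{X})=1)+\sup_{\boldsymbol{\mu}\in\Xi(s,B)}\mathbb{P}_{\theta,\boldsymbol{\mu}}(T(\mathbf{X})=0).$$ A sequence of tests (indexed by $n$) is asymptotically powerful if $\limsup_{n\to\infty}\mathrm{Risk}(T)=0$. All asymptotics are as $n\to\infty$; $a_n\gg b_n$ means $b_n=o(a_n)$. *)

(* Defs.v *)
From HB Require Import structures.
From mathcomp Require Import all_boot all_order all_algebra.
From mathcomp Require Import all_classical all_reals all_analysis.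
Set Implicit Arguments.
Unset Strict Implicit.
Unset Printing Implicit Defensive.
Import Order.TTheory GRing.Theory Num.Theory numFieldNormedType.Exports.
Local Open Scope classical_set_scope.
Local Open Scope ring_scope.

Definition tanh {R : realType} (x : R) : R :=
  (expR x - expR (- x)) / (expR x + expR (- x)).

(* {-1,+1}^n is encoded by booleans: [true] is the spin +1, [false] the
   spin -1. *)
Definition config (n : nat) := {ffun 'I_n -> bool}.

Definition spin {R : realType} {n : nat} (x : config n) (i : 'I_n) : R :=
  if x i then 1 else -1.

Definition sample_mean {R : realType} {n : nat} (x : config n) : R :=
  n%:R^-1 * \sum_(i < n) spin x i.

Section CurieWeiss.
Context {R : realType} {n : nat}.
Implicit Types (theta B : R) (mu : 'rV[R]_n) (x : config n) (s : nat).

Definition cw_weight theta mu x : R :=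
  expR (theta / n%:R * (\sum_(i < n) \sum_(j < n | (i < j)%N)
                          spin x i * spin x j)
        + \sum_(i < n) mu 0 i * spin x i).

Definition cw_partition theta mu : R := \sum_(x : config n) cw_weight theta mu x.

Definition cw_pmf theta mu x : R := cw_weight theta mu x / cw_partition theta mu.

Definition cw_prob theta mu (E : pred (config n)) : R :=
  \sum_(x : config n | E x) cw_pmf theta mu x.

Definition supp mu : {set 'I_n} := [set i | mu 0 i != 0]%SET.

Definition Xi s B : set 'rV[R]_n :=
  [set mu | #|supp mu| = s /\ forall i, i \in supp mu -> B <= mu 0 i].

(* A test is a boolean function of the configuration; [true] means that the
   null hypothesis is rejected.  The supremum is the real one: it is over a
   subset of [0, 1], nonempty when 1 <= s <= n. *)
Definition risk theta s B (T : config n -> bool) : R :=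
  cw_prob theta 0 (fun x => T x)
  + sup [set cw_prob theta mu (fun x => ~~ T x) | mu in Xi s B].

End CurieWeiss.

(* The risk takes its values in [0, 2], so the real-valued limit superior is
   the usual one. *)
Definition asymptotically_powerful {R : realType} (theta : R)
    (s : nat -> nat) (B : nat -> R) (T : forall n, config n -> bool) : Prop :=
  limn_sup (fun n => risk theta (s n) (B n) (T n)) = 0.

(* Main.v *)
Require Import Defs.
From HB Require Import structures.
From mathcomp Require Import all_boot all_order all_algebra.
From mathcomp Require Import all_classical all_reals all_analysis.
From mathcomp Require Import ring lra.
Set Implicit Arguments.
Unset Strict Implicit.
Unset Printing Implicit Defensive.
Import Order.TTheory GRing.Theory Num.Theory numFieldNormedType.Exports.
Local Open Scope classical_set_scope.
Local Open Scope ring_scope.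

(* With [N] plus spins, [S = 2 N - n] and [w i = exp (2 mu i)], the event
   [N = j] has probability proportional to
   [exp ((2 j - n) ^ 2 / (2 n)) * e_j(w)], [e_j] being the elementary symmetric
   function.  At [theta = 1] the null ratio of consecutive probabilities is
   [exp (- (2 / 3) v ^ 3)] up to lower order at [v = S / n], so the scale of [S]
   is [n ^ (3/4)] and [E_0 exp (lambda S)] is bounded for
   [lambda = O(n ^ (-3/4))].

   (i) A field with [s] entries at least [B] multiplies each of these ratios by
   at least [1 + s t / n], [t = tanh B], which beats the cubic drift as long as
   [S <= 2 L n ^ (3/4)] with [L ^ 3] a small multiple of [s t / n ^ (1/4)].  The
   probabilities then grow geometrically up to that level, so little mass is
   left below [L n ^ (3/4)].

   (ii) For a field equal to [B] on [A], [|A| = s], the likelihood ratio is at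
   most [\prod_(i in A) (1 + t x_i)], because the null expectation of this
   product is at least 1 by Griffiths' inequality.  By Maclaurin's inequality
   its average over [A] is at most [(1 + t S / n) ^ s <= exp (s t S / n)], whose
   second null moment is bounded. *)

(** * Elementary symmetric functions of weights *)

Section ElementarySymmetric.
Context {R : realFieldType} {I : finType}.
Implicit Types (w : I -> R) (A D : {set I}) (j : nat).

Definition elsym w D j : R := \sum_(A : {set I} | (A \subset D) && (#|A| == j))
  \prod_(i in A) w i.

Lemma elsym_ge0 w D j : (forall i, 0 <= w i) -> 0 <= elsym w D j.
Proof. by move=> w0; apply: sumr_ge0 => A _; apply: prodr_ge0 => i _. Qed.

Lemma elsym0 w D : elsym w D 0 = 1.
Proof.
rewrite /elsym (big_pred1 finset.set0) ?big_set0 // => A.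
by rewrite cards_eq0 andbC /=; case: eqP => //= ->; rewrite finset.sub0set.
Qed.

Lemma elsym_gt D w j : (#|D| < j)%N -> elsym w D j = 0.
Proof.
move=> Dj; rewrite /elsym big_pred0 // => A; apply/negP => /andP[/subset_leq_card].
by move=> AD /eqP Aj; rewrite Aj leqNgt Dj in AD.
Qed.

Lemma elsym_with w D j i : i \in D ->
  \sum_(A : {set I} | [&& A \subset D, #|A| == j.+1 & i \in A])
    \prod_(k in A) w k = w i * elsym w (D :\ i)%SET j.
Proof.
move=> iD; rewrite (reindex_onto (fun A => i |: A)%SET (fun A => A :\ i)%SET).
  rewrite /elsym mulr_sumr; apply: eq_big => A.
    rewrite finset.subUset finset.sub1set iD setU11 !andbT subsetD1 /=.
    case iA: (i \in A).
      rewrite andbF /=; apply/negbTE; rewrite !negb_and.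
      by apply/orP; right; apply/eqP => e; move: iA; rewrite -e setD11.
    by rewrite setU1K ?iA // eqxx cardsU1 iA add1n eqSS !andbT.
  by move=> /andP[_ /eqP e]; rewrite big_setU1 // -e setD11.
by move=> A /and3P[_ _ iA]; rewrite finset.setD1K.
Qed.

Lemma elsymS w D j i : i \in D ->
  elsym w D j.+1 = elsym w (D :\ i)%SET j.+1 + w i * elsym w (D :\ i)%SET j.
Proof.
move=> iD; rewrite -elsym_with // /elsym (bigID (fun A : {set I} => i \in A)) /= addrC.
congr (_ + _); apply: eq_bigl => A; first by rewrite subsetD1; do !case: (_ \in _); rewrite ?andbT ?andbF.
by rewrite -andbA.
Qed.

(** Double counting: a set of size [j.+1] arises once from each of its elements. *)
Lemma elsym_sum_del w D j :
  \sum_(i in D) w i * elsym w (D :\ i)%SET j = j.+1%:R * elsym w D j.+1.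
Proof.
under eq_bigr => i iD do rewrite -elsym_with //.
rewrite /elsym mulr_sumr (exchange_big_dep (fun A : {set I} => (A \subset D) && (#|A| == j.+1))) /=.
  apply: eq_bigr => A /andP[AD /eqP Aj].
  rewrite AD Aj eqxx /= sumr_const mulr_natl; congr (_ *+ _).
  rewrite -Aj; apply: eq_card => i; rewrite unfold_in /=.
  by case iA: (i \in A); [rewrite (fintype.subsetP AD _ iA)|rewrite andbF].
by move=> i A _ /and3P[-> -> _].
Qed.

Lemma elsym_sum w D j :
  \sum_(i in D) elsym w (D :\ i)%SET j = (#|D|%:R - j%:R) * elsym w D j.
Proof.
case: j => [|j].
  by under eq_bigr do rewrite elsym0; rewrite elsym0 sumr_const subr0 mulr1.
rewrite mulrBl -elsym_sum_del mulr_natl -sumr_const -sumrB.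
by apply: eq_bigr => i iD; rewrite (elsymS w j iD) addrK.
Qed.

Lemma elsym1S D j :
  j.+1%:R * elsym (fun=> 1) D j.+1 = (#|D|%:R - j%:R) * elsym (fun=> 1) D j.
Proof. by rewrite -elsym_sum_del -elsym_sum; under eq_bigr do rewrite mul1r. Qed.

Lemma elsym1_gt0 D j : (j <= #|D|)%N -> 0 < elsym (fun=> 1) D j.
Proof.
elim: j => [|j IH] jD; first by rewrite elsym0.
rewrite -(@pmulr_rgt0 _ j.+1%:R) // elsym1S mulr_gt0 ?IH ?(ltnW jD) //.
by rewrite subr_gt0 ltr_nat.
Qed.

Lemma elsym_step w D j : (forall i, 1 <= w i) ->
  (#|D|%:R - j%:R) * elsym w D j <= j.+1%:R * elsym w D j.+1.
Proof.
move=> w1; rewrite -elsym_sum -elsym_sum_del; apply: ler_sum => i _.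
by rewrite ler_peMl // elsym_ge0 // => k; apply: le_trans (w1 k).
Qed.

(** Beyond [elsym_step], each index of [A] contributes an excess [w i - 1 >= t * (w i + 1)], and
    [(1 + w i) * elsym w (D :\ i) j] is at least [1 - j / #|D|] times the function over [D]. *)
Lemma elsym_step_gain w A D j (t : R) : (forall i, 1 <= w i) -> A \subset D ->
  (j < #|D|)%N -> 0 <= t -> (forall i, i \in A -> t * (w i + 1) <= w i - 1) ->
  (#|D|%:R - j%:R) * (1 + #|A|%:R * t / #|D|%:R) * elsym w D j
    <= j.+1%:R * elsym w D j.+1.
Proof.
move=> w1 AD jD t0 wt; have w0 i : 0 <= w i by apply: le_trans (w1 i).
have D0 : 0 < #|D|%:R :> R by rewrite ltr0n; case: (#|D|) jD.
rewrite -elsym_sum_del mulrDr mulr1 mulrDl -elsym_sum.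
have -> : \sum_(i in D) w i * elsym w (D :\ i)%SET j =
    \sum_(i in D) elsym w (D :\ i)%SET j +
    \sum_(i in D) (w i - 1) * elsym w (D :\ i)%SET j.
  by rewrite -big_split; apply: eq_bigr => i _ /=; rewrite mulrBl mul1r addrC subrK.
rewrite lerD2l (big_setID A) /= (finset.setIidPr AD).
apply: ler_wpDr.
  by apply: sumr_ge0 => i _; rewrite mulr_ge0 ?elsym_ge0 // subr_ge0.
have -> : (#|D|%:R - j%:R) * (#|A|%:R * t / #|D|%:R) * elsym w D j =
    \sum_(i in A) t / #|D|%:R * ((#|D|%:R - j%:R) * elsym w D j).
  by rewrite sumr_const -mulr_natl; field; exact: lt0r_neq0.
apply: ler_sum => i iA; have iD := fintype.subsetP AD _ iA.
suff H : (#|D|%:R - j%:R) * elsym w D j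
    <= #|D|%:R * (1 + w i) * elsym w (D :\ i)%SET j.
  apply: (@le_trans _ _ (t / #|D|%:R * (#|D|%:R * (1 + w i) * elsym w (D :\ i)%SET j))).
    by rewrite ler_wpM2l // divr_ge0 // ltW.
  have -> : t / #|D|%:R * (#|D|%:R * (1 + w i) * elsym w (D :\ i)%SET j)
     = t * (w i + 1) * elsym w (D :\ i)%SET j by field; exact: lt0r_neq0.
  by rewrite ler_wpM2r ?elsym_ge0 // wt.
case: j jD => [|j] jD.
  by rewrite !elsym0 subr0 !mulr1 ler_peMr ?(ltW D0) // lerDl.
(* Both terms of [elsymS] are compared with [b], the function of degree [j.+1] over [D :\ i];
   [elsym_step] bounds the term of degree [j] by it. *)
rewrite (elsymS w j iD); have := @elsym_step w (D :\ i)%SET j w1.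
have -> : #|(D :\ i)%SET|%:R = #|D|%:R - 1 :> R.
  by rewrite (cardsD1 i D) iD natrD addrC addKr.
have e0 := elsym_ge0 (D :\ i)%SET j.+1 w0.
have j0 : 0 <= #|D|%:R - j.+1%:R :> R by rewrite subr_ge0 ler_nat ltnW.
move: (elsym _ _ j) (elsym _ _ j.+1) e0 => a b b0.
have -> : #|D|%:R - 1 - j%:R = #|D|%:R - j.+1%:R :> R by rewrite -natr1; ring.
move=> H.
apply: (@le_trans _ _ ((#|D|%:R - j.+1%:R) * b + w i * (j.+1%:R * b))).
  by rewrite mulrDr lerD2l mulrCA ler_wpM2l.
have -> : #|D|%:R * (1 + w i) * b = #|D|%:R * b + w i * (#|D|%:R * b) by ring.
apply: lerD; first by rewrite ler_wpM2r // lerBlDr lerDl.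
by rewrite ler_wpM2l // ler_wpM2r // ler_nat ltnW.
Qed.

(* Chebyshev's sum inequality: deleting a larger weight leaves a smaller
   elementary symmetric function. *)
Lemma elsym_chebyshev w D j : (forall i, 0 <= w i) ->
  #|D|%:R * \sum_(i in D) w i * elsym w (D :\ i)%SET j
    <= (\sum_(i in D) w i) * \sum_(i in D) elsym w (D :\ i)%SET j.
Proof.
move=> w0; pose g i := elsym w (D :\ i)%SET j.
(* In positive degree, splitting off both indices gives [g k - g i = (w i - w k) * b] with [b >= 0],
   so the product is a square times [b]. *)
have anti i k : i \in D -> k \in D -> 0 <= (w i - w k) * (g k - g i).
  move=> iD kD; have [->|ik] := eqVneq i k; first by rewrite subrr mul0r.
  rewrite {}/g; case: j => [|j]; first by rewrite !elsym0 subrr mulr0.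
  have ki : k \in (D :\ i)%SET by rewrite !inE eq_sym ik.
  have ik' : i \in (D :\ k)%SET by rewrite !inE ik.
  rewrite (elsymS w j ki) (elsymS w j ik').
  have -> : (D :\ k :\ i = D :\ i :\ k)%SET by apply/setP => x; rewrite !inE andbCA.
  set b := elsym w _ j; have -> : forall a, (w i - w k) * (a + w i * b - (a + w k * b))
    = (w i - w k) ^+ 2 * b by move=> a; ring.
  by rewrite mulr_ge0 ?sqr_ge0 // elsym_ge0.
have : 0 <= \sum_(i in D) \sum_(k in D) (w i - w k) * (g k - g i).
  by apply: sumr_ge0 => i iD; apply: sumr_ge0 => k kD; apply: anti.
have -> : \sum_(i in D) \sum_(k in D) (w i - w k) * (g k - g i) =
    ((\sum_(i in D) w i) * (\sum_(i in D) g i)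
      - #|D|%:R * \sum_(i in D) w i * g i) *+ 2.
  transitivity (\sum_(i in D) (w i * (\sum_(k in D) g k)
      - #|D|%:R * (w i * g i) - \sum_(k in D) w k * g k
      + g i * \sum_(k in D) w k)).
    apply: eq_bigr => i iD.
    transitivity (\sum_(k in D) (w i * g k - w i * g i - w k * g k + g i * w k)).
      by apply: eq_bigr => k _; ring.
    by rewrite !big_split /= !sumrN sumr_const -!mulr_sumr mulr_natl.
  rewrite !big_split /= !sumrN sumr_const -!mulr_suml -!mulr_sumr -mulr_natl -mulr_natr.
  ring.
by rewrite pmulrn_lge0 // subr_ge0.
Qed.

(** Induction on the degree: relative to unit weights, for which [elsym] is a binomial coefficient,
    Chebyshev makes each step cost at most a factor equal to the mean weight. *)
Lemma maclaurin w j D : (forall i, 0 <= w i) -> (j <= #|D|)%N ->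
  #|D|%:R ^+ j * elsym w D j <= (\sum_(i in D) w i) ^+ j * elsym (fun=> 1) D j.
Proof.
move=> w0; elim: j => [|j IH] jD; first by rewrite !elsym0 !expr0.
rewrite -(@ler_pM2l _ j.+1%:R) // mulrCA -elsym_sum_del [leRHS]mulrCA elsym1S.
have j0 : 0 <= #|D|%:R - j%:R :> R by rewrite subr_ge0 ler_nat ltnW.
rewrite exprSr -mulrA; apply: (@le_trans _ _
    (#|D|%:R ^+ j * ((\sum_(i in D) w i) * ((#|D|%:R - j%:R) * elsym w D j)))).
  by rewrite ler_wpM2l ?exprn_ge0 // -elsym_sum elsym_chebyshev.
have W0 : 0 <= \sum_(i in D) w i by apply: sumr_ge0.
have := ler_wpM2l (mulr_ge0 W0 j0) (IH (ltnW jD)).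
by rewrite exprS; congr (_ <= _); ring.
Qed.

End ElementarySymmetric.

(** * Cubic bounds for the log-odds function *)

Section LogOddsBounds.
Context {R : realType}.
Implicit Types (v c : R).

Let logodds c v : R := ln (1 + v) - ln (1 - v) - (2 * v + c * v ^+ 3).

Let is_derive_logodds c v : -1 < v < 1 ->
  is_derive v 1 (logodds c) ((1 + v)^-1 + (1 - v)^-1 - (2 + c * (3 * v ^+ 2))).
Proof.
move=> /andP[v1 v2].
have h1 : is_derive (1 + v) 1 (@ln R) (1 + v)^-1 by apply: is_derive1_ln; lra.
have h2 : is_derive (1 - v) 1 (@ln R) (1 - v)^-1 by apply: is_derive1_ln; lra.
have d1 : is_derive v 1 (fun y : R => ln (1 + y)) (1 + v)^-1.
  have := @is_derive1_comp R (@ln R) (fun y => 1 + y) v (1 + v)^-1 1 h1.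
  by rewrite mulr1; apply; apply: is_derive_eq; ring.
have d2 : is_derive v 1 (fun y : R => ln (1 - y)) (- (1 - v)^-1).
  have := @is_derive1_comp R (@ln R) (fun y => 1 - y) v (1 - v)^-1 (-1) h2.
  by rewrite mulrN1; apply; apply: is_derive_eq; ring.
rewrite /logodds; apply: is_derive_eq.
rewrite opprK /GRing.scale /=. congr (_ - _); ring.
Qed.

(** Reduces the sign of [logodds] to that of its derivative, which is nonnegative for [c = 2 / 3]
    and, up to [y = 1 / 2], nonpositive for [c = 2]. *)
Let logodds_MVT c v : 0 <= v < 1 -> exists2 y, 0 <= y <= v &
  logodds c v = (2 * y ^+ 2 / (1 - y ^+ 2) - 3 * c * y ^+ 2) * v.
Proof.
move=> /andP[v0 v1].
have D y : y \in `[0, v] -> -1 < y < 1.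
  by rewrite in_itv /= => /andP[y0 yv]; apply/andP; split; lra.
have [||y yv] := @MVT_segment R (logodds c)
    (fun v => (1 + v)^-1 + (1 - v)^-1 - (2 + c * (3 * v ^+ 2))) 0 v v0.
- by move=> y /subset_itv_oo_cc yv; apply: is_derive_logodds; apply: D.
- apply: derivable_within_continuous => y yv.
  exact: (@ex_derive _ _ _ _ _ _ _ (is_derive_logodds c (D y yv))).
rewrite /logodds addr0 subr0 ln1 subrr expr0n /= !mulr0 addr0 !subr0 => ->.
exists y; first by move: yv; rewrite in_itv.
have /andP[y1 y2] := D _ yv.
have n1 : 1 + y != 0 by rewrite lt0r_neq0 //; lra.
have n2 : 1 - y != 0 by rewrite lt0r_neq0 //; lra.
rewrite (_ : 1 - y ^+ 2 = (1 - y) * (1 + y)); last by ring.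
by congr (_ * _); field; apply/andP; split.
Qed.

Lemma odds_le v : 0 <= v < 1 ->
  (1 - v) * expR (2 * v + 2 / 3 * v ^+ 3) <= 1 + v.
Proof.
move=> v01; have [y /andP[y0 yv] E] := logodds_MVT (2 / 3) v01.
have /andP[v0 v1] := v01.
have p1 : 0 < 1 - v by lra.
have p2 : 0 < 1 + v by lra.
rewrite -ler_pdivlMl // [leRHS]mulrC -[leRHS]lnK ?posrE ?divr_gt0 // ler_expR.
rewrite ln_div ?posrE // -subr_ge0 -/(logodds _ _) E mulr_ge0 //.
have y2 : 0 < 1 - y ^+ 2 by nra.
rewrite subr_ge0 ler_pdivlMr //; nra.
Qed.

(** The cubic Taylor coefficient [2 / 3] is enlarged to [2] to absorb the higher-order terms up to
    [v = 1 / 2]. *)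
Lemma odds_ge v : 0 <= v <= 1 / 2 ->
  1 + v <= (1 - v) * expR (2 * v + 2 * v ^+ 3).
Proof.
move=> /andP[v0 v2].
have v01 : 0 <= v < 1 by rewrite v0 /=; lra.
have [y /andP[y0 yv] E] := logodds_MVT 2 v01.
have p1 : 0 < 1 - v by lra.
have p2 : 0 < 1 + v by lra.
rewrite -ler_pdivrMl // [leLHS]mulrC -[leLHS]lnK ?posrE ?divr_gt0 // ler_expR.
rewrite ln_div ?posrE // -subr_le0 -/(logodds _ _) E mulr_le0_ge0 //.
have y2 : 0 < 1 - y ^+ 2 by nra.
have y4 : y ^+ 2 <= 1 / 4 by nra.
rewrite subr_le0 ler_pdivrMr //; move: (y ^+ 2) (sqr_ge0 y) y4 => z z0 z4; nra.
Qed.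

End LogOddsBounds.

(** * Mass bounds from geometric growth *)

Section GeometricShift.
Context {R : realFieldType}.
Implicit Types (b : nat -> R) (P : pred nat) (eta : R) (J N : nat).

Let bernoulli eta J : 0 <= eta -> 1 + eta * J%:R <= (1 + eta) ^+ J.
Proof.
move=> e0; elim: J => [|J IH]; first by rewrite mulr0 addr0 expr0.
rewrite exprSr -natr1; apply: le_trans (ler_wpM2r _ IH); last lra.
have : 0 <= J%:R :> R by []. nra.
Qed.

(** Each term on [P] is compared with its translate by [J], gaining [(1 + eta) ^+ J >= 1 + eta * J];
    the translates are distinct terms of the full sum, or vanish from [N] on. *)
Lemma shift_up_sum b P eta J N : (forall j, 0 <= b j) -> 0 <= eta ->
  (forall j, (N <= j)%N -> b j = 0) ->
  (forall j i, P j -> (i < J)%N -> (1 + eta) * b (j + i)%N <= b (j + i).+1) ->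
  (1 + eta * J%:R) * \sum_(j < N | P j) b j <= \sum_(j < N) b j.
Proof.
move=> b0 e0 bN grow.
have e1 : 0 <= 1 + eta by lra.
have pw j i : P j -> (i <= J)%N -> (1 + eta) ^+ i * b j <= b (j + i)%N.
  move=> Pj; elim: i => [|i IH] iJ; first by rewrite expr0 mul1r addn0.
  rewrite addnS exprS -mulrA; apply: le_trans (grow j i Pj iJ).
  by rewrite ler_wpM2l // IH // ltnW.
rewrite mulr_sumr; apply: (@le_trans _ _ (\sum_(j < N | P j) b (j + J)%N)).
  apply: ler_sum => j Pj; apply: le_trans (pw j J Pj (leqnn _)).
  by rewrite ler_wpM2r // bernoulli.
apply: (@le_trans _ _ (\sum_(j < N) b (j + J)%N)).
  by rewrite [leRHS](bigID (fun j : 'I_N => P j)) /= lerDl sumr_ge0.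
rewrite -(big_mkord xpredT (fun j => b (j + J)%N)) -(big_mkord xpredT b).
have -> : \sum_(0 <= j < N) b j = \sum_(0 <= j < J + N) b j.
  rewrite addnC [RHS](@big_cat_nat _ _ _ N) ?leq_addr //=.
  by rewrite [X in _ + X]big_nat_cond [X in _ + X]big1 ?addr0 // => i /andP[/andP[/bN]].
rewrite (@big_cat_nat _ _ _ J 0 (J + N)) ?leq_addr //=.
have -> : \sum_(J <= j < J + N) b j = \sum_(0 <= j < N) b (j + J)%N.
  by rewrite -{1}[J]add0n big_addn addKn.
by rewrite lerDr sumr_ge0.
Qed.

(** The mirror image; having [J <= j] on [P] keeps the truncated subtraction injective, so the
    translates are again distinct. *)
Lemma shift_down_sum b P eta J N : (forall j, 0 <= b j) -> 0 <= eta ->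
  (forall j, P j -> (J <= j)%N) ->
  (forall j i, P j -> (i < J)%N -> (1 + eta) * b (j - i)%N <= b (j - i.+1)%N) ->
  (1 + eta * J%:R) * \sum_(j < N | P j) b j <= \sum_(j < N) b j.
Proof.
move=> b0 e0 PJ grow.
have e1 : 0 <= 1 + eta by lra.
have pw j i : P j -> (i <= J)%N -> (1 + eta) ^+ i * b j <= b (j - i)%N.
  move=> Pj; elim: i => [|i IH] iJ; first by rewrite expr0 mul1r subn0.
  rewrite exprS -mulrA; apply: le_trans (grow j i Pj iJ).
  by rewrite ler_wpM2l // IH // ltnW.
rewrite mulr_sumr; apply: (@le_trans _ _ (\sum_(j < N | P j) b (j - J)%N)).
  apply: ler_sum => j Pj; apply: le_trans (pw j J Pj (leqnn _)).
  by rewrite ler_wpM2r // bernoulli.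
apply: (@le_trans _ _ (\sum_(j < N | (J <= j)%N) b (j - J)%N)).
  rewrite big_mkcond [leRHS]big_mkcond; apply: ler_sum => j _.
  by case: ifP => [/PJ -> //|_]; case: ifP.
rewrite -(big_mkord (fun j => J <= j)%N (fun j => b (j - J)%N)) -(big_mkord xpredT b).
have [NJ|JN] := leqP N J.
  rewrite big_nat_cond big1 ?sumr_ge0 // => j /andP[/andP[_ jN] Jj].
  by move: (leq_ltn_trans Jj jN); rewrite ltnNge NJ.
rewrite (@big_cat_nat _ _ _ J 0 N) ?(ltnW JN) //= [X in X + _]big_nat_cond big1 ?add0r; last first.
  by move=> j /andP[/andP[_ jN] Jj]; move: (leq_ltn_trans Jj jN); rewrite ltnn.
have := @big_addn R 0 +%R 0 N J (fun j => J <= j)%N (fun j => b (j - J)%N).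
rewrite add0n => ->; rewrite (eq_big xpredT b); first last.
- by move=> j _; rewrite addnK.
- by move=> j; rewrite leq_addl.
rewrite [leRHS](@big_cat_nat _ _ _ (N - J)) ?leq_subr //=.
by rewrite lerDl sumr_ge0.
Qed.

End GeometricShift.

(** * Law of the number of plus spins *)

Definition pluses n (x : config n) : {set 'I_n} := [set i | x i]%SET.

Section MagnetizationLaw.
Context {R : realType} {n : nat}.
Implicit Types (mu : 'rV[R]_n) (x : config n) (j : nat).

Lemma sum_spin x : \sum_(i < n) spin x i = 2 * #|pluses x|%:R - n%:R :> R.
Proof.
have -> : n%:R = \sum_(i < n) 1 :> R by rewrite sumr_const card_ord.
have -> : #|pluses x|%:R = \sum_(i < n) (x i)%:R :> R.
  rewrite -sumr_const big_mkcond /=; apply: eq_bigr => i _; rewrite inE.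
  by case: (x i).
rewrite mulr_sumr -sumrB; apply: eq_bigr => i _; rewrite /spin.
by case: (x i) => /=; ring.
Qed.

Lemma sum_pairs x :
  \sum_(i < n) \sum_(j < n | (i < j)%N) spin x i * spin x j
    = ((\sum_(i < n) spin x i) ^+ 2 - n%:R) / 2 :> R.
Proof.
pose f (i j : 'I_n) : R := spin x i * spin x j.
have diag : \sum_(i < n) f i i = n%:R.
  transitivity (\sum_(i < n) (1 : R)); last by rewrite sumr_const card_ord.
  by apply: eq_bigr => i _; rewrite /f /spin; case: (x i); ring.
have lower : \sum_(i < n) \sum_(j < n | (j < i)%N) f i j
           = \sum_(i < n) \sum_(j < n | (i < j)%N) f i j.
  rewrite (exchange_big_dep xpredT) //=; apply: eq_bigr => i _.
  by apply: eq_bigr => j _; rewrite /f mulrC.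
have -> : (\sum_(i < n) spin x i) ^+ 2 = \sum_(i < n) \sum_(j < n) f i j :> R.
  rewrite expr2 mulr_suml; apply: eq_bigr => i _.
  by rewrite mulr_sumr.
suff -> : \sum_(i < n) \sum_(j < n) f i j =
    \sum_(i < n) \sum_(j < n | (i < j)%N) f i j + n%:R +
    \sum_(i < n) \sum_(j < n | (j < i)%N) f i j.
  by rewrite lower -/(f _ _); set a := BIG_F; field.
rewrite -diag -!big_split; apply: eq_bigr => i _ /=.
rewrite (bigID (fun j : 'I_n => i < j)%N) /= -addrA; congr (_ + _).
rewrite (bigD1 i) ?ltnn //=; congr (_ + _); apply: eq_bigl => j.
by rewrite -leqNgt ltn_neqAle andbC.
Qed.

(** Configurations correspond to their sets of plus positions; grouping these by cardinality
    produces the elementary symmetric functions. *)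
Lemma sum_config (phi : nat -> R) (w : 'I_n -> R) :
  \sum_(x : config n) phi #|pluses x| * \prod_(i in pluses x) w i
    = \sum_(j < n.+1) phi j * elsym w finset.setT j.
Proof.
rewrite (reindex (fun A : {set 'I_n} => [ffun i => i \in A])) /=; last first.
  exists (fun x => pluses x) => y _; first by apply/setP => i; rewrite inE ffunE.
  by apply/ffunP => i; rewrite ffunE inE.
have plusE (A : {set 'I_n}) : pluses [ffun i => i \in A] = A.
  by apply/setP => i; rewrite inE ffunE.
under eq_bigr do rewrite plusE.
have cardA (A : {set 'I_n}) : (#|A| < n.+1)%N.
  by rewrite ltnS -[X in (_ <= X)%N]card_ord max_card.
rewrite (partition_big (fun A => Ordinal (cardA A)) xpredT) //=.
apply: eq_bigr => j _; rewrite /elsym mulr_sumr; apply: eq_big => A.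
  by rewrite finset.subsetT /= -val_eqE.
by rewrite -val_eqE /= => /eqP ->.
Qed.

(** The pair interaction at [theta = 1], without the constant [expR (- (1 / 2))] that the diagonal
    of the squared sum produces. *)
Definition boltzmann j : R := expR ((2 * j%:R - n%:R) ^+ 2 / (2 * n%:R)).

Definition field_weight mu (i : 'I_n) : R := expR (2 * mu 0 i).

Lemma boltzmann_gt0 j : 0 < boltzmann j.
Proof. exact: expR_gt0. Qed.

Lemma boltzmannS j : (0 < n)%N ->
  boltzmann j.+1 = boltzmann j * expR (2 * ((2 * j%:R + 1 - n%:R) / n%:R)).
Proof.
move=> n0; rewrite /boltzmann -expRD; congr expR; rewrite -natr1; field.
by rewrite pnatr_eq0 -lt0n.
Qed.

Lemma cw_weightE mu x : (0 < n)%N ->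
  cw_weight 1 mu x = expR (- (1 / 2) - \sum_(i < n) mu 0 i) *
    (boltzmann #|pluses x| * \prod_(i in pluses x) field_weight mu i).
Proof.
move=> n0; have nn : n%:R != 0 :> R by rewrite pnatr_eq0 -lt0n.
rewrite /cw_weight /boltzmann /field_weight -expR_sum -!expRD; congr expR.
rewrite sum_pairs sum_spin.
have -> : \sum_(i in pluses x) 2 * mu 0 i
    = \sum_(i < n) mu 0 i * spin x i + \sum_(i < n) mu 0 i.
  rewrite -big_split big_mkcond /=; apply: eq_bigr => i _; rewrite inE /spin.
  by case: (x i); ring.
by set a := \sum_(i < n) _ * _; set b := \sum_(i < n) _; field.
Qed.

Lemma cw_weight_gt0 (theta : R) mu x : 0 < cw_weight theta mu x.
Proof. exact: expR_gt0. Qed.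

Lemma cw_partition_gt0 (theta : R) mu : 0 < cw_partition theta mu.
Proof.
rewrite /cw_partition (bigD1 [ffun=> true]) //= ltr_wpDr ?cw_weight_gt0 //.
by apply: sumr_ge0 => x _; rewrite ltW ?cw_weight_gt0.
Qed.

Lemma cw_pmf_ge0 (theta : R) mu x : 0 <= cw_pmf theta mu x.
Proof. by rewrite divr_ge0 // ltW ?cw_weight_gt0 ?cw_partition_gt0. Qed.

Lemma cw_pmf_sum (theta : R) mu : \sum_x cw_pmf theta mu x = 1.
Proof. by rewrite -mulr_suml divff // lt0r_neq0 // cw_partition_gt0. Qed.

Lemma cw_prob_ge0 (theta : R) mu (E : pred (config n)) : 0 <= cw_prob theta mu E.
Proof. by apply: sumr_ge0 => x _; apply: cw_pmf_ge0. Qed.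

Lemma cw_probC (theta : R) mu (E : pred (config n)) :
  cw_prob theta mu (fun x => ~~ E x) = 1 - cw_prob theta mu E.
Proof.
by rewrite -(cw_pmf_sum theta mu) (bigID E) /= /cw_prob addrAC subrr add0r.
Qed.

Lemma cw_prob_le1 (theta : R) mu (E : pred (config n)) : cw_prob theta mu E <= 1.
Proof. by rewrite -subr_ge0 -cw_probC cw_prob_ge0. Qed.

Lemma cw_sum_weight mu (phi : nat -> R) : (0 < n)%N ->
  \sum_x cw_weight 1 mu x * phi #|pluses x|
  = expR (- (1 / 2) - \sum_(i < n) mu 0 i) *
    \sum_(j < n.+1) boltzmann j * elsym (field_weight mu) finset.setT j * phi j.
Proof.
move=> n0.
transitivity (expR (- (1 / 2) - \sum_(i < n) mu 0 i) *
  \sum_x (boltzmann #|pluses x| * phi #|pluses x|) * \prod_(i in pluses x) field_weight mu i).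
  by rewrite mulr_sumr; apply: eq_bigr => x _; rewrite cw_weightE //; ring.
rewrite (sum_config (fun j => boltzmann j * phi j)).
by congr (_ * _); apply: eq_bigr => j _; rewrite mulrAC.
Qed.

Lemma cw_expectation mu (phi : nat -> R) : (0 < n)%N ->
  (\sum_(j < n.+1) boltzmann j * elsym (field_weight mu) finset.setT j) *
    (\sum_x cw_pmf 1 mu x * phi #|pluses x|) =
  \sum_(j < n.+1) boltzmann j * elsym (field_weight mu) finset.setT j * phi j.
Proof.
move=> n0; have Z0 := cw_partition_gt0 1 mu.
have e0 := expR_gt0 (- (1 / 2) - \sum_(i < n) mu 0 i).
have := cw_sum_weight mu (fun=> 1) n0; have := cw_sum_weight mu phi n0.
move: (expR _) e0 => e e0 Ephi; rewrite -[\sum_x _ * 1]mulr_suml.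
under [X in e * X]eq_bigr do rewrite mulr1.
rewrite mulr1 -/(cw_partition 1 mu) => EZ.
apply: (@mulfI _ e (lt0r_neq0 e0)); rewrite -Ephi mulrA -EZ.
rewrite mulr_sumr; apply: eq_bigr => x _; rewrite /cw_pmf.
by field; exact: lt0r_neq0.
Qed.

End MagnetizationLaw.

(** * Ratios of consecutive magnetization probabilities *)

Section CriticalRatios.
Context {R : realType} {n : nat}.
Implicit Types (j : nat) (U c lam : R).

(** Centring with [n + 1] makes [(1 + v) / (1 - v)] equal to [(j + 1) / (n - j)], so that [odds_le]
    applies; the term [2 / n] pays for the change of denominator from [n] to [n + 1]. *)
Lemma ratio_le j c : (j < n)%N -> n%:R <= 2 * j%:R + 1 :> R ->
  let v := (2 * j%:R + 1 - n%:R) / (n%:R + 1) : R in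
  c <= 2 / 3 * v ^+ 3 - 2 / n%:R ->
  expR (2 * ((2 * j%:R + 1 - n%:R) / n%:R) + c) * (n%:R - j%:R) <= j%:R + 1 :> R.
Proof.
move=> jn nj v hc.
have n0 : 0 < n%:R :> R by rewrite ltr0n (leq_ltn_trans _ jn).
have jnR : j%:R + 1 <= n%:R :> R by rewrite natr1 ler_nat.
have n1 : 0 < n%:R + 1 :> R by lra.
have v0 : 0 <= v by rewrite divr_ge0 //; lra.
have v1 : v < 1 by rewrite ltr_pdivrMr //; lra.
have p1 : 0 < 1 - v by lra.
have E1 : (1 - v) * (n%:R + 1) = 2 * (n%:R - j%:R).
  by rewrite /v; field; exact: lt0r_neq0.
have E2 : (1 + v) * (n%:R + 1) = 2 * (j%:R + 1).
  by rewrite /v; field; exact: lt0r_neq0.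
have E3 : (2 * j%:R + 1 - n%:R) / n%:R = v + v / n%:R.
  by rewrite /v; field; rewrite !lt0r_neq0.
have vn : v / n%:R <= 1 / n%:R by rewrite ler_wpM2r ?invr_ge0 ?(ltW n0) // ltW.
rewrite -(@ler_pM2l _ 2) // -E2 mulrCA -E1.
apply: (@le_trans _ _ ((1 - v) * expR (2 * v + 2 / 3 * v ^+ 3) * (n%:R + 1))).
  rewrite mulrCA mulrA ler_wpM2r ?(ltW n1) // ler_wpM2l ?(ltW p1) // ler_expR E3.
  have : 2 / n%:R = 2 * (1 / n%:R) :> R by rewrite mul1r.
  by lra.
by rewrite ler_wpM2r ?(ltW n1) // odds_le // v0.
Qed.

Lemma ratio_ge j U : (j < n)%N -> 0 <= U <= 1 / 2 ->
  2 * j%:R + 1 - n%:R <= U * n%:R ->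
  (1 - 2 * U ^+ 3 - 2 / n%:R) * (j%:R + 1) <=
  expR (2 * ((2 * j%:R + 1 - n%:R) / n%:R)) * (n%:R - j%:R) :> R.
Proof.
move=> jn /andP[U0 U1] jU.
have n0 : 0 < n%:R :> R by rewrite ltr0n (leq_ltn_trans _ jn).
have jnR : j%:R + 1 <= n%:R :> R by rewrite natr1 ler_nat.
have j0 : 0 <= j%:R :> R by [].
have n1 : 0 < n%:R + 1 :> R by lra.
pose v := (2 * j%:R + 1 - n%:R) / (n%:R + 1) : R.
pose u := (2 * j%:R + 1 - n%:R) / n%:R : R.
have E1 : (1 - v) * (n%:R + 1) = 2 * (n%:R - j%:R).
  by rewrite /v; field; exact: lt0r_neq0.
have E2 : (1 + v) * (n%:R + 1) = 2 * (j%:R + 1).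
  by rewrite /v; field; exact: lt0r_neq0.
have E3 : u = v + v / n%:R by rewrite /u /v; field; rewrite !lt0r_neq0.
have v1 : v < 1 by rewrite ltr_pdivrMr //; lra.
have vN1 : -1 < v by rewrite ltr_pdivlMr //; lra.
have in0 : 0 < 1 / n%:R :> R by rewrite divr_gt0.
have in2 : 2 / n%:R = 2 * (1 / n%:R) :> R by rewrite mul1r.
have uU : u <= U by rewrite ler_pdivrMr.
rewrite -/u; clearbody u v.
(* Any odds bound with exponent [c] suffices, through [expR (2 * u - c) >= 1 + (2 * u - c)]. *)
have key c : 1 + v <= (1 - v) * expR c ->
    1 - 2 * U ^+ 3 - 2 / n%:R <= 1 + (2 * u - c) ->
    (1 - 2 * U ^+ 3 - 2 / n%:R) * (j%:R + 1) <= expR (2 * u) * (n%:R - j%:R).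
  move=> hc hU; rewrite -(@ler_pM2l _ 2) // mulrCA -E2 [leRHS]mulrCA -E1.
  rewrite [leLHS]mulrA [leRHS]mulrA.
  rewrite ler_wpM2r ?(ltW n1) //.
  apply: (@le_trans _ _ (expR (2 * u - c) * ((1 - v) * expR c))); last first.
    by rewrite mulrCA -expRD subrK [leLHS]mulrC.
  apply: (@le_trans _ _ (expR (2 * u - c) * (1 + v))); last first.
    by rewrite ler_wpM2l ?expR_ge0.
  rewrite ler_wpM2r //; first lra.
  exact: le_trans hU (expR_ge1Dx _).
have [v0|v0] := leP 0 v.
  have vn : 0 <= v / n%:R by rewrite divr_ge0 // ltW.
  have vU : v <= U by lra.
  apply: (key _ (odds_ge _)); first by rewrite v0 /=; lra.
  have : v ^+ 3 <= U ^+ 3 by rewrite lerXn2r ?nnegrE.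
  by rewrite E3; lra.
have U3 : 0 <= U ^+ 3 by rewrite exprn_ge0.
have v3 : v ^+ 3 <= 0 by rewrite exprS nmulr_rle0 // sqr_ge0.
(* For negative [v], [odds_le] at [- v] yields the exponent [2 * v] once its cubic term is
   dropped. *)
apply: (key (2 * v)).
  have := @odds_le R (- v); rewrite opprK => H.
  have : (1 + v) * expR (2 * - v + 2 / 3 * (- v) ^+ 3) <= 1 - v.
    by apply: H; apply/andP; split; lra.
  move=> {}H; have {}H := ler_wpM2r (expR_ge0 (2 * v)) H.
  apply: le_trans H; rewrite -[leRHS]mulrA -expRD -[leLHS]mulr1 ler_wpM2l //; first lra.
  rewrite -[leLHS]expR0 ler_expR (_ : (- v) ^+ 3 = - v ^+ 3); last by ring.
  lra.
have : - (1 / n%:R) <= v / n%:R.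
  by rewrite -mulNr ler_wpM2r ?invr_ge0 ?(ltW n0) // ltW.
by rewrite E3; lra.
Qed.

End CriticalRatios.

(** * Exponential moments under the null hypothesis *)

Section NullMoment.
Context {R : realType} {n : nat}.
Implicit Types (C r lam : R).

Lemma field_weight0 : @field_weight R n 0 = fun=> 1.
Proof. by apply/funext => i; rewrite /field_weight mxE mulr0 expR0. Qed.

(* Tilting the null law of the magnetization by [lam] leaves at most half of its
   mass above the level [(2 C + 10) r ^ 3]; on the rest the tilt is bounded. *)
Lemma cw_exp_moment C r lam : 0 <= C -> (0 < n)%N -> 0 < r -> r ^+ 4 = n%:R ->
  0 <= lam -> lam * r ^+ 3 <= C ->
  \sum_x cw_pmf 1 (0 : 'rV[R]_n) x * expR (lam * \sum_(i < n) spin x i)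
    <= 2 * expR (C * (2 * C + 10)).
Proof.
move=> C0 n0 r0 rn lam0 lamC.
have nR : 1 <= n%:R :> R by rewrite ler1n.
have r1 : 1 <= r.
  by rewrite leNgt; apply/negP => r1; move: nR; rewrite -rn leNgt exprn_ilt1 // ltW.
have r3 : 1 <= r ^+ 3 by rewrite exprn_ege1.
pose phi j := expR (lam * (2 * j%:R - n%:R)) : R.
pose a j := @boltzmann R n j * elsym (fun=> 1) [set: 'I_n]%SET j.
pose b j := a j * phi j.
have a0 j : 0 <= a j by rewrite mulr_ge0 ?(ltW (boltzmann_gt0 _)) ?elsym_ge0.
have b0 j : 0 <= b j by rewrite mulr_ge0 // expR_ge0.
have := cw_expectation (0 : 'rV[R]_n) phi n0; rewrite field_weight0 -/a => E.
rewrite (eq_bigr (fun x => cw_pmf 1 (0 : 'rV[R]_n) x * phi #|pluses x|)); last first.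
  by move=> x _; rewrite sum_spin.
have A0 : 0 < \sum_(j < n.+1) a j.
  rewrite big_ord_recl ltr_wpDr ?sumr_ge0 //.
  by rewrite /a elsym0 mulr1 boltzmann_gt0.
rewrite -(ler_pM2l A0) E.
(* The scale n ^ (-3/4) in which the drift is measured: [1 / n <= q] and [lam <= C * q]. *)
pose q := r^-1 ^+ 3.
have q0 : 0 < q by rewrite exprn_gt0 // invr_gt0.
have qr : q * r ^+ 3 = 1 by rewrite /q exprVn mulVf // lt0r_neq0 // exprn_gt0.
have nq : 1 / n%:R <= q.
  rewrite -rn /q -exprVn mul1r (exprS _ 3) ler_piMl ?(ltW q0) //.
  by rewrite invf_le1.
have lamq : lam <= C * q.
  have -> : lam = lam * r ^+ 3 * q by rewrite -mulrA [_ * q]mulrC qr mulr1.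
  by rewrite ler_wpM2r // ltW.
(* Descending at most [J <= 2 * r ^+ 3] steps costs [4 * r ^+ 3]; the remaining
   [(2 * C + 6) * r ^+ 3] gives [v >= (C + 3) / r], since [n + 1 <= 2 * r ^+ 4]. *)
pose M : R := 2 * C + 10.
(* Large enough that [q * J >= 1], so the shift gains a factor of at least 2. *)
pose J := (Num.truncn (r ^+ 3)).+1.
have J1 : r ^+ 3 <= J%:R by rewrite ltW // /J truncnS_gt.
have J2 : J%:R <= 2 * r ^+ 3.
  rewrite /J -natr1; have : (Num.truncn (r ^+ 3))%:R <= r ^+ 3 by rewrite truncn_le exprn_ge0 // ltW.
  lra.
pose P j := (j <= n)%N && (M * r ^+ 3 <= 2 * j%:R - n%:R).
have PJ j : P j -> (J <= j)%N.
  move=> /andP[_ jM]; rewrite -(ler_nat R); apply: le_trans J2 _.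
  have : 0 <= C * r ^+ 3 by rewrite mulr_ge0 // exprn_ge0 // ltW.
  by rewrite /M in jM; lra.
(* The cubic drift [2 / 3 * v ^+ 3] dominates [2 * lam + q + 2 / n <= (2 * C + 3) * q]; the summand
   [q] yields the growth factor [1 + q]. *)
have step j : (j < n)%N -> (C + 3) * r^-1 <= (2 * j%:R + 1 - n%:R) / (n%:R + 1) ->
    (1 + q) * b j.+1 <= b j.
  pose v := (2 * j%:R + 1 - n%:R) / (n%:R + 1) : R.
  rewrite -/v => jn hv.
  have Cr : 0 <= (C + 3) * r^-1 by rewrite mulr_ge0 ?invr_ge0 ?(ltW r0) //; lra.
  have v0 : 0 <= v by apply: le_trans Cr hv.
  have v3 : (C + 3) ^+ 3 * q <= v ^+ 3.
    by rewrite /q -exprMn lerXn2r ?nnegrE.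
  have C3 : 3 + 2 * C <= 2 / 3 * (C + 3) ^+ 3 - 2.
    have -> : (C + 3) ^+ 3 = C ^+ 3 + 9 * C ^+ 2 + 27 * C + 27 by ring.
    have : 0 <= C ^+ 3 by rewrite exprn_ge0.
    have : 0 <= C ^+ 2 by rewrite exprn_ge0.
    lra.
  have nv : n%:R <= 2 * j%:R + 1 :> R.
    by rewrite -subr_ge0 -(@pmulr_lge0 _ (n%:R + 1)^-1) // invr_gt0; lra.
  have in2 : 2 / n%:R = 2 * (1 / n%:R) :> R by rewrite mul1r.
  have C3q := ler_wpM2r (ltW q0) C3.
  have := @ratio_le R n j (2 * lam + q) jn nv; rewrite -/v => H.
  have {}H : expR (2 * ((2 * j%:R + 1 - n%:R) / n%:R) + (2 * lam + q))
      * (n%:R - j%:R) <= j%:R + 1 by apply: H; rewrite in2; lra.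
  rewrite -(@ler_pM2l _ (j%:R + 1)); last by rewrite natr1 ltr0n.
  have phiS : phi j.+1 = phi j * expR (2 * lam).
    by rewrite /phi -expRD -natr1; congr expR; ring.
  have -> : (j%:R + 1) * ((1 + q) * b j.+1) = (1 + q) *
     (expR (2 * ((2 * j%:R + 1 - n%:R) / n%:R)) * expR (2 * lam) * (n%:R - j%:R)) * b j.
    have := @elsym1S R 'I_n [set: 'I_n]%SET j; rewrite cardsT card_ord -natr1 => e1.
    rewrite /b /a phiS boltzmannS //.
    transitivity ((1 + q) * (@boltzmann R n j * expR (2 * ((2 * j%:R + 1 - n%:R) / n%:R)) *
      ((j%:R + 1) * elsym (fun=> 1) [set: 'I_n]%SET j.+1) * (phi j * expR (2 * lam)))).
      by ring.
    by rewrite e1; ring.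
  rewrite ler_wpM2r //; apply: le_trans H.
  rewrite -expRD [X in _ <= expR X * _]addrA [X in _ <= X * _]expRD [leLHS]mulrA.
  rewrite ler_wpM2r //.
    by rewrite subr_ge0 ler_nat ltnW.
  by rewrite [leLHS]mulrC ler_wpM2l ?expR_ge0 // expR_ge1Dx.
have half : 2 * \sum_(j < n.+1 | P j) b j <= \sum_(j < n.+1) b j.
  apply: (@le_trans _ _ ((1 + q * J%:R) * \sum_(j < n.+1 | P j) b j)).
    rewrite ler_wpM2r ?sumr_ge0 //.
    have := ler_wpM2l (ltW q0) J1; rewrite qr; lra.
  apply: shift_down_sum => //; first exact: ltW.
  move=> j i Pj iJ.
  have Jj := PJ j Pj; have ij : (i < j)%N by apply: leq_trans Jj.
  rewrite -[(j - i)%N](subnSK ij).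
  case/andP: Pj => jn jM; apply: step.
    by rewrite subnSK // (leq_trans (leq_subr _ _)).
  have : i.+1%:R <= J%:R :> R by rewrite ler_nat.
  rewrite natrB // => iJR.
  have rr : r^-1 * r ^+ 4 = r ^+ 3 by rewrite exprS mulrA mulVf ?mul1r // lt0r_neq0.
  rewrite ler_pdivlMr; last lra.
  have D0 : 0 <= (C + 3) * r^-1 by rewrite mulr_ge0 ?invr_ge0 ?(ltW r0) //; lra.
  apply: (@le_trans _ _ ((C + 3) * r^-1 * (2 * r ^+ 4))).
    by rewrite ler_wpM2l // rn; lra.
  have -> : (C + 3) * r^-1 * (2 * r ^+ 4) = (2 * C + 6) * r ^+ 3.
    by rewrite -rr; ring.
  by rewrite /M in jM; lra.
have rest : \sum_(j < n.+1 | ~~ P j) b j <= expR (C * M) * \sum_(j < n.+1) a j.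
  apply: (@le_trans _ _ (\sum_(j < n.+1 | ~~ P j) a j * expR (C * M))).
    apply: ler_sum => j; rewrite /P -ltnS ltn_ord /= -ltNge => jM.
    rewrite ler_wpM2l // ler_expR.
    apply: (@le_trans _ _ (lam * (M * r ^+ 3))); first by rewrite ler_wpM2l // ltW.
    by rewrite mulrCA [C * M]mulrC ler_wpM2l // /M; lra.
  rewrite -mulr_suml mulrC ler_wpM2l ?expR_ge0 //.
  by rewrite [leRHS](bigID (fun j : 'I_n.+1 => P j)) /= lerDr sumr_ge0.
change (\sum_(j < n.+1) b j <= (\sum_(j < n.+1) a j) * (2 * expR (C * M))).
have : \sum_(j < n.+1) b j =
    \sum_(j < n.+1 | P j) b j + \sum_(j < n.+1 | ~~ P j) b j.
  by rewrite (bigID (fun j : 'I_n.+1 => P j)).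
move: half rest.
move: (\sum_(j < n.+1) b j) (\sum_(j < n.+1 | P j) b j) (\sum_(j < n.+1 | ~~ P j) b j).
move: (\sum_(j < n.+1) a j) (expR (C * M)) => *; lra.
Qed.

End NullMoment.

(** * Lower tail of the magnetization under an alternative *)

Section Power.
Context {R : realType} {n : nat}.

(* Below the level [2 L r ^ 3] every additional plus spin raises the
   probability of the magnetization by at least the factor [1 + s t / (2 n)]. *)
Lemma cw_lower_tail (mu : 'rV[R]_n) (s : nat) (t r L : R) :
  (0 < n)%N -> 0 < r -> r ^+ 4 = n%:R -> 0 <= t -> t <= 1 ->
  (forall i, 0 <= mu 0 i) -> (s = #|supp mu|)%N ->
  (forall i, i \in supp mu -> t * (field_weight mu i + 1) <= field_weight mu i - 1) ->
  4 <= L -> 4 * L <= r -> 64 * L ^+ 3 + 8 <= s%:R * t / r ->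
  (1 + s%:R * t * L / (8 * r)) * cw_prob 1 mu (fun x => \sum_(i < n) spin x i < L * r ^+ 3) <= 1.
Proof.
move=> n0 r0 rn t0 t1 mu0 sE wt L4 Lr La.
have nR : 1 <= n%:R :> R by rewrite ler1n.
have n0R : 0 < n%:R :> R by lra.
have r1 : 1 <= r by lra.
have r3 : 1 <= r ^+ 3 by rewrite exprn_ege1.
have r30 : 0 < r ^+ 3 by lra.
pose w := field_weight mu.
have w1 i : 1 <= w i.
  by rewrite -[leLHS]expR0 ler_expR mulr_ge0.
have w0 i : 0 <= w i by apply: le_trans (w1 i).
pose b j := @boltzmann R n j * elsym w [set: 'I_n]%SET j.
have b0 j : 0 <= b j by rewrite mulr_ge0 ?(ltW (boltzmann_gt0 _)) ?elsym_ge0.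
have B0 : 0 < \sum_(j < n.+1) b j.
  rewrite big_ord_recl ltr_wpDr ?sumr_ge0 //.
  by rewrite /b elsym0 mulr1 boltzmann_gt0.
pose P j := 2 * j%:R - n%:R < L * r ^+ 3.
have := cw_expectation mu (fun j => (P j)%:R) n0; rewrite -/w -/b => E.
have -> : cw_prob 1 mu (fun x => \sum_(i < n) spin x i < L * r ^+ 3) =
    \sum_x cw_pmf 1 mu x * (P #|pluses x|)%:R.
  rewrite /cw_prob big_mkcond /=; apply: eq_bigr => x _.
  by rewrite sum_spin -/(P _); case: ifP; rewrite ?mulr1 ?mulr0.
rewrite -(ler_pM2l B0) mulrCA mulr1 E.
have {E} -> : \sum_(j < n.+1) b j * (P j)%:R = \sum_(j < n.+1 | P j) b j.
  rewrite [RHS]big_mkcond /=; apply: eq_bigr => j _.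
  by case: ifP; rewrite ?mulr1 ?mulr0.
set sg : R := s%:R * t.
have sg0 : 0 <= sg by rewrite mulr_ge0.
have sn : (s <= n)%N by rewrite sE -[X in (_ <= X)%N]card_ord max_card.
have sgn : sg <= n%:R.
  apply: (@le_trans _ _ s%:R); last by rewrite ler_nat.
  by rewrite -[leRHS]mulr1 ler_wpM2l.
(* With this many steps, a magnetization starting below [L * r ^+ 3] stays below
   [2 * L * r ^+ 3]. *)
pose J := Num.truncn (L * r ^+ 3 / 2).
have Lr3 : 4 <= L * r ^+ 3 by rewrite -[leLHS]mulr1 ler_pM //; lra.
have J1 : J%:R <= L * r ^+ 3 / 2 by rewrite truncn_le; lra.
have J2 : L * r ^+ 3 / 4 <= J%:R.
  have : L * r ^+ 3 / 2 < J.+1%:R by rewrite truncnS_gt.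
  rewrite -[J.+1%:R]natr1; lra.
(* Half of the gain [sg / n] from [elsym_step_gain]; the other half absorbs the cubic drift. *)
pose eta := sg / (2 * n%:R).
have eta0 : 0 <= eta by rewrite divr_ge0 // mulr_ge0 // ltW.
have etaJ : sg * L / (8 * r) <= eta * J%:R.
  have -> : sg * L / (8 * r) = eta * (L * r ^+ 3 / 4).
    by rewrite /eta -rn; field; exact: lt0r_neq0.
  by rewrite ler_wpM2l.
apply: (@le_trans _ _ ((1 + eta * J%:R) * \sum_(j < n.+1 | P j) b j)).
  by rewrite ler_wpM2r ?sumr_ge0 // lerD2l.
apply: shift_up_sum => // [j nj|j i Pj iJ].
  by rewrite /b elsym_gt ?mulr0 // cardsT card_ord.
set k := (j + i)%N.
have kR : 2 * k%:R + 1 - n%:R <= 2 * L * r ^+ 3.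
  have : i%:R + 1 <= J%:R :> R by rewrite natr1 ler_nat.
  by rewrite /P in Pj; rewrite /k natrD; lra.
pose U := 2 * L / r.
have U2 : U <= 1 / 2 by rewrite ler_pdivrMr //; lra.
have U0 : 0 <= U by rewrite divr_ge0 ?(ltW r0) //; lra.
have UE : U * n%:R = 2 * L * r ^+ 3.
  by rewrite /U -rn; field; exact: lt0r_neq0.
have kn : (k < n)%N.
  rewrite -(ltr_nat R); have := ler_wpM2r (ltW n0R) U2; rewrite UE; lra.
have kU : 2 * k%:R + 1 - n%:R <= U * n%:R by rewrite UE.
have U01 : 0 <= U <= 1 / 2 by rewrite U0.
have H := ratio_ge kn U01 kU.
have G := @elsym_step_gain R 'I_n w (supp mu) [set: 'I_n]%SET k t w1
  (finset.subsetT _).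
rewrite cardsT card_ord in G; have {}G := G kn t0 wt.
rewrite -sE -/sg in G.
have k1 : 0 < k%:R + 1 :> R by rewrite natr1 ltr0n.
rewrite -(@ler_pM2l _ (k%:R + 1)) //.
have -> : (k%:R + 1) * b k.+1 =
    @boltzmann R n k * expR (2 * ((2 * k%:R + 1 - n%:R) / n%:R)) *
      (k.+1%:R * elsym w [set: 'I_n]%SET k.+1).
  by rewrite /b boltzmannS // -natr1; ring.
have F0 := @boltzmann_gt0 R n k.
apply: le_trans (ler_wpM2l (mulr_ge0 (ltW F0) (expR_ge0 _)) G).
have e0 : 0 <= elsym w [set: 'I_n]%SET k by apply: elsym_ge0.
rewrite /b.
set e := elsym _ _ _ in e0 *; set x := expR _ in H *; set f := boltzmann k in F0 *.
have -> : (k%:R + 1) * ((1 + eta) * (f * e)) = f * e * ((1 + eta) * (k%:R + 1)) by ring.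
have -> : f * x * ((n%:R - k%:R) * (1 + sg / n%:R) * e) =
  f * e * ((1 + sg / n%:R) * (x * (n%:R - k%:R))) by ring.
rewrite ler_wpM2l ?mulr_ge0 ?(ltW F0) //.
have y0 : 0 <= sg / n%:R by rewrite divr_ge0 // ltW.
have y1 : sg / n%:R <= 1 by rewrite ler_pdivrMr // mul1r.
apply: (@le_trans _ _ ((1 + sg / n%:R) * ((1 - 2 * U ^+ 3 - 2 / n%:R) * (k%:R + 1)))); last first.
  by rewrite ler_wpM2l //; lra.
rewrite mulrA ler_wpM2r ?(ltW k1) //.
have etaE : eta = sg / n%:R / 2 by rewrite /eta; field; exact: lt0r_neq0.
(* The drift [z] is at most a quarter of the gain [y], which is what [64 * L ^+ 3 + 8] encodes; as
   [y <= 1], this gives [(1 + y) * (1 - z) >= 1 + y - 2 * z >= 1 + y / 2]. *)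
have Un : 4 * (2 * U ^+ 3 + 2 / n%:R) <= sg / n%:R.
  rewrite ler_pdivlMr //.
  have -> : 4 * (2 * U ^+ 3 + 2 / n%:R) * n%:R = (64 * L ^+ 3) * r + 8.
    by rewrite /U -rn; field; exact: lt0r_neq0.
  have : (64 * L ^+ 3 + 8) * r <= sg by rewrite -ler_pdivlMr.
  lra.
have z0 : 0 <= 2 * U ^+ 3 + 2 / n%:R.
  have U3 : 0 <= U ^+ 3 by rewrite exprn_ge0.
  have : 0 <= 2 / n%:R :> R by rewrite divr_ge0 // ltW.
  lra.
rewrite etaE.
have -> : 1 - 2 * U ^+ 3 - 2 / n%:R = 1 - (2 * U ^+ 3 + 2 / n%:R) by ring.
move: (2 * U ^+ 3 + 2 / n%:R) (sg / n%:R) z0 y0 y1 Un => z y; nra.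
Qed.

End Power.

(** * Griffiths' inequality *)

Section Griffiths.
Context {R : realType} {n : nat}.
Implicit Types (f g : config n -> R) (i : 'I_n).

(* Indexing correlations by exponents rather than by subsets makes
   multiplication by a spin a shift of the index. *)
Definition corr_nonneg f : Prop := forall c : 'I_n -> nat,
  0 <= \sum_x f x * \prod_i spin x i ^+ c i.

(** Stated as a closure property so that the factors of the Boltzmann weight can be multiplied in
    one at a time. *)
Definition preserves_corr g : Prop := forall f,
  corr_nonneg f -> corr_nonneg (fun x => f x * g x).

(** The sum factorizes over sites, and a site contributes 2 or 0 according to the parity of its
    exponent. *)
Lemma corr_nonneg1 : corr_nonneg (fun=> 1).
Proof.
move=> c; pose F (i : 'I_n) (b : bool) : R := (if b then 1 else -1) ^+ c i.
under eq_bigr do rewrite mul1r.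
rewrite -(bigA_distr_bigA F); apply: prodr_ge0 => i _.
rewrite big_bool /F expr1n -signr_odd.
by case: odd => /=; rewrite ?expr1 ?expr0; lra.
Qed.

Lemma corr_nonneg_affine (a b : R) (y : config n -> R) f : 0 <= a -> 0 <= b ->
  corr_nonneg f -> corr_nonneg (fun x => f x * y x) ->
  corr_nonneg (fun x => f x * (a + b * y x)).
Proof.
move=> a0 b0 hf hy c.
have -> : \sum_x f x * (a + b * y x) * \prod_i spin x i ^+ c i =
    a * (\sum_x f x * \prod_i spin x i ^+ c i) +
    b * (\sum_x f x * y x * \prod_i spin x i ^+ c i).
  by rewrite !mulr_sumr -big_split; apply: eq_bigr => x _ /=; ring.
by rewrite addr_ge0 // mulr_ge0.
Qed.

Lemma preserves_spin i : preserves_corr (fun x => spin x i).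
Proof.
move=> f hf c; have := hf (fun k => ((k == i) + c k)%N).
congr (_ <= _); apply: eq_bigr => x _; rewrite -mulrA; congr (_ * _).
under eq_bigr do rewrite exprD.
rewrite big_split /= (bigD1 i) //= eqxx expr1 big1 ?mulr1 //.
by move=> k /negbTE ->; rewrite expr0.
Qed.

Lemma preserves_corr_sum (I : Type) (l : seq I) (P : pred I) (h : I -> config n -> R) :
  (forall k, P k -> preserves_corr (fun x => expR (h k x))) ->
  preserves_corr (fun x => expR (\sum_(k <- l | P k) h k x)).
Proof.
move=> hh; elim: l => [|k l IH] f hf c.
  by under eq_bigr do rewrite big_nil expR0 mulr1.
under eq_bigr do rewrite big_cons.
case Pk: (P k); last exact: IH.
under eq_bigr do rewrite expRD mulrA.
by apply: IH; apply: hh.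
Qed.

(** A product of two spins is [1] or [-1], so its exponential is affine in it, with the nonnegative
    coefficients cosh a and sinh a. *)
Lemma preserves_pair (a : R) i j : 0 <= a ->
  preserves_corr (fun x => expR (a * (spin x i * spin x j))).
Proof.
move=> a0 f hf; pose ch := (expR a + expR (- a)) / 2; pose sh := (expR a - expR (- a)) / 2.
have -> : (fun x => f x * expR (a * (spin x i * spin x j))) =
    (fun x => f x * (ch + sh * (spin x i * spin x j))).
  apply/funext => x; congr (_ * _); rewrite /ch /sh /spin.
  by case: (x i); case: (x j); rewrite ?mulr1 ?mulrN1 ?opprK ?mulr1; field.
apply: corr_nonneg_affine => //.
- by rewrite divr_ge0 ?addr_ge0 ?expR_ge0.
- by rewrite divr_ge0 // subr_ge0 ler_expR; lra.
- have -> : (fun x => f x * (spin x i * spin x j)) = (fun x => f x * spin x i * spin x j).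
    by apply/funext => x; rewrite mulrA.
  exact/preserves_spin/preserves_spin.
Qed.

Lemma corr_nonneg_cw (theta : R) : 0 <= theta ->
  corr_nonneg (@cw_weight R n theta 0).
Proof.
move=> th0; have a0 : 0 <= theta / n%:R by rewrite divr_ge0.
have -> : @cw_weight R n theta 0 = (fun x => 1 * expR
    (\sum_(i < n) \sum_(j < n | (i < j)%N) theta / n%:R * (spin x i * spin x j))).
  apply/funext => x; rewrite mul1r /cw_weight; congr expR.
  rewrite mulr_sumr [X in _ + X]big1 ?addr0 => [|i _]; last by rewrite mxE mul0r.
  by apply: eq_bigr => i _; rewrite mulr_sumr.
apply: preserves_corr_sum corr_nonneg1 => i _.
apply: preserves_corr_sum => j _; exact: preserves_pair.
Qed.

(** The factors are absorbed into [f] one by one; each preserves [corr_nonneg] and raises the sum by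
    [t] times a nonnegative correlation. *)
Lemma griffiths_prod (t : R) (l : seq 'I_n) f : 0 <= t -> corr_nonneg f ->
  \sum_x f x <= \sum_x f x * \prod_(i <- l) (1 + t * spin x i).
Proof.
move=> t0; elim: l f => [|i l IH] f hf.
  by under [leRHS]eq_bigr do rewrite big_nil mulr1.
have hfi := preserves_spin i hf.
have := IH _ (corr_nonneg_affine ler01 t0 hf hfi).
under [X in _ <= X -> _]eq_bigr do rewrite -mulrA.
under [X in _ -> _ <= X]eq_bigr do rewrite big_cons.
apply: le_trans.
have -> : \sum_x f x * (1 + t * spin x i) = \sum_x f x + t * \sum_x f x * spin x i.
  by rewrite mulr_sumr -big_split; apply: eq_bigr => x _ /=; ring.
rewrite lerDl mulr_ge0 //.
have := hfi (fun=> 0%N).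
by under eq_bigr do rewrite big1 ?mulr1 //.
Qed.

End Griffiths.

(** * Hyperbolic tangent *)

Section Hyperbolic.
Context {R : realType}.
Implicit Types B m : R.

Lemma cosh_gt0 B : 0 < expR B + expR (- B).
Proof. by rewrite addr_gt0 ?expR_gt0. Qed.

Lemma tanh_ge0 B : 0 <= B -> 0 <= tanh B.
Proof.
by move=> B0; rewrite /tanh divr_ge0 ?(ltW (cosh_gt0 B)) // subr_ge0 ler_expR; lra.
Qed.

Lemma tanh_le1 B : tanh B <= 1.
Proof.
by rewrite /tanh ler_pdivrMr ?cosh_gt0 // mul1r; have := expR_gt0 (- B); lra.
Qed.

(** Monotonicity of [tanh], cleared of denominators into the form that [elsym_step_gain] takes. *)
Lemma tanh_expR B m : B <= m ->
  tanh B * (expR (2 * m) + 1) <= expR (2 * m) - 1.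
Proof.
move=> Bm; rewrite /tanh mulrAC ler_pdivrMr ?cosh_gt0 //.
have -> : expR (2 * m) = expR m * expR m by rewrite -expRD; congr expR; ring.
have h1 : expR B * expR (- B) = 1 by rewrite -expRD subrr expR0.
have h2 : expR B <= expR m by rewrite ler_expR.
have hm := expR_gt0 m; have hb := expR_gt0 B; have hn := expR_gt0 (- B).
have h3 : expR B * expR B <= expR m * expR m by rewrite ler_pM // ltW.
move: (expR m * expR m) h3 => w h3.
move: (expR (- B)) (expR B) h1 hn hb h3 => q p h1 q0 p0 h3.
have : p <= w * q.
  by rewrite -[leLHS]mulr1 -h1 mulrA ler_wpM2r // ltW.
nra.
Qed.

End Hyperbolic.

(** * Likelihood ratios and the lower bound on the risk *)

Section SecondMoment.
Context {R : realType} {n : nat}.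
Implicit Types (A : {set 'I_n}) (B : R) (s : nat).

Definition signal B A : 'rV[R]_n := \row_i (if i \in A then B else 0).

Lemma signal_Xi B A s : 0 < B -> #|A| = s -> Xi s B (signal B A).
Proof.
move=> B0 As; have sA : supp (signal B A) = A.
  apply/setP => i; rewrite inE mxE; case: ifP; rewrite ?eqxx //.
  by rewrite lt0r_neq0.
by split => [|i]; rewrite sA // mxE => ->.
Qed.

Lemma spin_tilt_ge0 (t : R) (x : config n) (i : 'I_n) : 0 <= t <= 1 ->
  0 <= 1 + t * spin x i.
Proof. by move=> /andP[t0 t1]; rewrite /spin; case: (x i); lra. Qed.

(** For a spin x, exp (B x) = cosh B (1 + x tanh B). The powers of cosh B cancel between the weight
    and the partition function, which Griffiths' inequality bounds from below. *)
Lemma cw_pmf_signal_le B A x : 0 < B ->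
  cw_pmf 1 (signal B A) x
    <= cw_pmf 1 (0 : 'rV[R]_n) x * \prod_(i in A) (1 + tanh B * spin x i).
Proof.
move=> B0; pose ch := (expR B + expR (- B)) / 2.
have ch0 : 0 < ch by rewrite divr_gt0 // cosh_gt0.
have t0 := tanh_ge0 (ltW B0); have t1 := tanh_le1 B.
pose W x := \prod_(i in A) (1 + tanh B * @spin R n x i).
have weightE y : cw_weight 1 (signal B A) y = ch ^+ #|A| * (cw_weight 1 (0 : 'rV[R]_n) y * W y).
  rewrite /cw_weight expRD [X in _ = _ * (expR (_ + X) * _)]big1; last first.
    by move=> i _; rewrite mxE mul0r.
  rewrite addr0 mulrCA; congr (_ * _).
  rewrite /W -prodr_const -big_split /= expR_sum [RHS]big_mkcond /=.
  apply: eq_bigr => i _; rewrite mxE; case: (i \in A); last by rewrite mul0r expR0.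
  have c0 : expR B + expR (- B) != 0 by rewrite lt0r_neq0 // cosh_gt0.
  by rewrite /ch /tanh /spin; case: (y i); rewrite ?mulr1 ?mulrN1; field.
have W0 : 0 <= W x by apply: prodr_ge0 => i _; rewrite spin_tilt_ge0 // t0.
have Z0 := cw_partition_gt0 1 (0 : 'rV[R]_n).
have ZA : ch ^+ #|A| * cw_partition 1 (0 : 'rV[R]_n) <= cw_partition 1 (signal B A).
  rewrite [leRHS]/cw_partition; under [leRHS]eq_bigr do rewrite weightE.
  rewrite -mulr_sumr ler_wpM2l ?exprn_ge0 ?(ltW ch0) //.
  have := griffiths_prod (enum A) t0 (@corr_nonneg_cw R n 1 ler01).
  congr (_ <= _); apply: eq_bigr => y _; congr (_ * _).
  by rewrite big_enum.
rewrite /cw_pmf weightE ler_pdivrMr ?cw_partition_gt0 //.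
rewrite -/(W x).
have w0 := cw_weight_gt0 1 (0 : 'rV[R]_n) x.
have := ler_wpM2l (mulr_ge0 (divr_ge0 (ltW w0) (ltW Z0)) W0) ZA.
apply: le_trans; rewrite le_eqVlt; apply/orP; left; apply/eqP.
by move: (cw_partition 1 0) Z0 => Z Z0; field; exact: lt0r_neq0.
Qed.

Lemma sum_signal_pmf_le B s x : 0 < B -> (s <= n)%N -> (0 < n)%N ->
  \sum_(A : {set 'I_n} | #|A| == s) cw_pmf 1 (signal B A) x
    <= #|[set A : {set 'I_n} | #|A| == s]%SET|%:R *
       (cw_pmf 1 (0 : 'rV[R]_n) x *
         expR (s%:R * tanh B / n%:R * \sum_(i < n) spin x i)).
Proof.
move=> B0 sn n0; have t0 := tanh_ge0 (ltW B0); have t1 := tanh_le1 B.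
have n0R : 0 < n%:R :> R by rewrite ltr0n.
pose w i := 1 + tanh B * @spin R n x i.
have w0 i : 0 <= w i by rewrite spin_tilt_ge0 // t0.
have eE (v : 'I_n -> R) : elsym v [set: 'I_n]%SET s =
    \sum_(A : {set 'I_n} | #|A| == s) \prod_(i in A) v i.
  by apply: eq_bigl => A; rewrite finset.subsetT.
have -> : #|[set A : {set 'I_n} | #|A| == s]%SET|%:R = elsym (fun=> 1 : R) [set: 'I_n]%SET s.
  rewrite eE -sumr_const; apply: eq_big => A; first by rewrite inE.
  by rewrite big1.
have := @maclaurin R 'I_n w s [set: 'I_n]%SET w0; rewrite cardsT card_ord => /(_ sn) M.
apply: (@le_trans _ _ (cw_pmf 1 (0 : 'rV[R]_n) x * elsym w [set: 'I_n]%SET s)).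
  rewrite eE mulr_sumr; apply: ler_sum => A _; exact: cw_pmf_signal_le.
rewrite mulrCA ler_wpM2l ?cw_pmf_ge0 //.
have nS : 0 < n%:R ^+ s :> R by rewrite exprn_gt0.
rewrite -(ler_pM2l nS); apply: le_trans M _.
rewrite mulrCA mulrC ler_wpM2l ?elsym_ge0 //.
set S := \sum_(i < n) spin x i.
have -> : \sum_(i in [set: 'I_n]%SET) w i = n%:R * (1 + tanh B * S / n%:R).
  rewrite (eq_bigl xpredT); last by move=> i; rewrite inE.
  rewrite /w big_split /= sumr_const card_ord -mulr_sumr -/S.
  by field; exact: lt0r_neq0.
rewrite exprMn ler_wpM2l ?(ltW nS) //.
have -> : s%:R * tanh B / n%:R * S = s%:R * (tanh B * S / n%:R) by ring.
rewrite expRM_natl lerXn2r ?nnegrE ?expR_ge0 ?expR_ge1Dx //.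
(* Raising [1 + y <= expR y] to the power [s] requires a nonnegative base; it is the mean of the
   nonnegative [w i]. *)
have -> : 1 + tanh B * S / n%:R = (\sum_(i < n) w i) / n%:R.
  rewrite /w big_split /= sumr_const card_ord -mulr_sumr -/S.
  by field; exact: lt0r_neq0.
by rewrite divr_ge0 ?(ltW n0R) // sumr_ge0.
Qed.

(** As [s] is arbitrary here, [Xi s B] may be empty; the supremum then takes the default value 0. *)
Lemma risk_bounds (s : nat) B (T : config n -> bool) :
  [/\ 0 <= risk 1 s B T,
    cw_prob 1 (0 : 'rV[R]_n) (fun x => T x) <= risk 1 s B T,
    risk 1 s B T <= 2 &
    forall mu, Xi s B mu -> cw_prob 1 (0 : 'rV[R]_n) (fun x => T x) +
      cw_prob 1 mu (fun x => ~~ T x) <= risk 1 s B T].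
Proof.
rewrite /risk; set E := [set _ | _ in _]; set p := cw_prob 1 0 _.
have p0 : 0 <= p := cw_prob_ge0 _ _ _.
have p1 : p <= 1 := cw_prob_le1 _ _ _.
have ub : ubound E 1 by move=> _ [mu _ <-]; exact: cw_prob_le1.
have hub : has_ubound E by exists 1.
have le_sup mu : Xi s B mu -> cw_prob 1 mu (fun x => ~~ T x) <= sup E.
  by move=> hmu; apply: ub_le_sup => //; exists mu.
have supE0 : 0 <= sup E.
  have [[_ [mu hmu _]]|/set0P/negP/negPn/eqP ->] := pselect (E !=set0).
    exact: le_trans (cw_prob_ge0 _ _ _) (le_sup mu hmu).
  by rewrite sup0.
have supE1 : sup E <= 1.
  have [E0|/set0P/negP/negPn/eqP ->] := pselect (E !=set0); first exact: ge_sup.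
  by rewrite sup0.
split; [lra|lra|lra|move=> mu hmu; have := le_sup mu hmu; lra].
Qed.

(* The supremum dominates the average over all supports of size [s]; under that
   average the rejection probability is at most [E_0 (T y)] with
   [y = exp (s t S / n)], and [y <= 2 K + y ^ 2 / (2 K)]. *)
Lemma risk_lower_bound (s : nat) B (T : config n -> bool) (K : R) :
  (0 < n)%N -> 0 < B -> (s <= n)%N -> 1 <= K ->
  \sum_x cw_pmf 1 (0 : 'rV[R]_n) x *
    expR (2 * (s%:R * tanh B / n%:R) * \sum_(i < n) spin x i) <= K ->
  1 <= 4 * K * risk 1 s B T.
Proof.
move=> n0 B0 sn K1 mK.
have [r0 pr _ hr] := risk_bounds s B T; move: r0 pr hr.
set rk := risk 1 s B T; set p := cw_prob 1 0 _ => r0 pr hr.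
set lam := s%:R * tanh B / n%:R in mK *.
pose m := #|[set A : {set 'I_n} | #|A| == s]%SET|.
have m0 : 0 < m%:R :> R.
  have := @elsym1_gt0 R 'I_n [set: 'I_n]%SET s; rewrite cardsT card_ord => /(_ sn).
  congr (_ < _); rewrite /elsym /m -sumr_const; apply: eq_big => A.
    by rewrite finset.subsetT inE.
  by rewrite big1.
(* Each signal has type II error at most [rk - p], hence is rejected with probability at least
   [1 - (rk - p)]; this is summed over all supports. *)
have avg : m%:R * (1 - (rk - p)) <= m%:R * \sum_(x | T x)
    cw_pmf 1 (0 : 'rV[R]_n) x * expR (lam * \sum_(i < n) spin x i).
  apply: (@le_trans _ _ (\sum_(A : {set 'I_n} | #|A| == s)
      cw_prob 1 (signal B A) (fun x => T x))).
    rewrite mulr_natl /m -sumr_const [leRHS](eq_bigl (fun A => A \in [set A : {set 'I_n} | #|A| == s]%SET)).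
      apply: ler_sum => A; rewrite inE => /eqP As.
      by have := hr _ (signal_Xi B0 As); rewrite cw_probC; lra.
    by move=> A; rewrite inE.
  rewrite /cw_prob exchange_big mulr_sumr; apply: ler_sum => x _.
  exact: sum_signal_pmf_le.
move: avg; rewrite ler_pM2l // => avg.
have : \sum_(x | T x) cw_pmf 1 (0 : 'rV[R]_n) x * expR (lam * \sum_(i < n) spin x i)
    <= 2 * K * p + (2 * K)^-1 * K.
  apply: (@le_trans _ _ (\sum_(x | T x) (2 * K * cw_pmf 1 (0 : 'rV[R]_n) x +
     (2 * K)^-1 * (cw_pmf 1 (0 : 'rV[R]_n) x * expR (2 * lam * \sum_(i < n) spin x i))))).
    apply: ler_sum => x _.
    have -> : 2 * lam * \sum_(i < n) spin x i = lam * (\sum_(i < n) spin x i) + lam * (\sum_(i < n) spin x i) by ring.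
    rewrite expRD; move: (expR _) (expR_ge0 (lam * \sum_(i < n) spin x i)) => y y0.
    move: (cw_pmf _ _ _) (cw_pmf_ge0 1 (0 : 'rV[R]_n) x) => q q0.
    rewrite -subr_ge0 (_ : _ - _ = q * (2 * K)^-1 * ((2 * K - y) ^+ 2 + 2 * K * y)); last first.
      by field; rewrite lt0r_neq0 //; lra.
    rewrite !mulr_ge0 ?invr_ge0 //; first lra.
    by rewrite addr_ge0 ?sqr_ge0 // mulr_ge0 //; lra.
  rewrite big_split /= -!mulr_sumr lerD2l ler_wpM2l ?invr_ge0; [by []|lra|].
  apply: le_trans mK; rewrite [leRHS](bigID T) /= lerDl sumr_ge0 // => x _.
  by rewrite mulr_ge0 ?cw_pmf_ge0 ?expR_ge0.
have -> : (2 * K)^-1 * K = 1 / 2 by field; rewrite lt0r_neq0 //; lra.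
have p0 : 0 <= p by exact: cw_prob_ge0.
(* Now [1 - rk + p <= 2 * K * p + 1 / 2], so [1 / 2 <= rk + (2 * K - 1) * p <= 2 * K * rk] because
   [p <= rk]. *)
nra.
Qed.

End SecondMoment.

(** * Fourth-root scaling and limits of the risk *)

Section Asymptotics.
Context {R : realType}.

Lemma fourth_rootX (n : nat) : (n%:R `^ 4^-1 : R) ^+ 4 = n%:R.
Proof. by rewrite -powR_mulrn ?powR_ge0 // -powRrM mulVf // powRr1. Qed.

Lemma fourth_root_gt0 (n : nat) : (0 < n)%N -> 0 < n%:R `^ 4^-1 :> R.
Proof. by move=> n0; rewrite powR_gt0 // ltr0n. Qed.

Lemma cube_rootX (x : R) : 0 <= x -> (x `^ 3^-1) ^+ 3 = x.
Proof. by move=> x0; rewrite -powR_mulrn ?powR_ge0 // -powRrM mulVf // powRr1. Qed.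

(** Type I error by Markov's inequality for an exponential moment, type II error by [cw_lower_tail].
    The choice [L ^+ 3 = a / 128] turns the condition there into [a / 2 + 8 <= a], that is
    [16 <= a]. *)
Lemma risk_magnetization_test_le (n s : nat) (B L : R) : (0 < n)%N -> (s <= n)%N ->
  0 < B -> let r := n%:R `^ 4^-1 in let a := s%:R * tanh B / r in
  4 <= L -> L ^+ 3 = a / 128 -> 16 <= a ->
  risk 1 s B (fun x : config n => L <= r * sample_mean x)
    <= (2 * expR 12 + 1) / L.
Proof.
move=> n0 sn B0 r a L4 L3 a16.
have r0 : 0 < r := fourth_root_gt0 n0.
have rn : r ^+ 4 = n%:R := fourth_rootX n.
have r30 : 0 < r ^+ 3 by rewrite exprn_gt0.
have L0 : 0 < L by lra.
have t0 := tanh_ge0 (ltW B0); have t1 := tanh_le1 B.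
have testE (x : config n) : (L <= r * sample_mean x) = (L * r ^+ 3 <= \sum_(i < n) spin x i).
  rewrite /sample_mean -rn -ler_pdivlMr //; congr (_ <= _).
  by field; exact: lt0r_neq0.
have stn : s%:R * tanh B <= r ^+ 4.
  rewrite rn; apply: (@le_trans _ _ (s%:R * 1)); first by rewrite ler_wpM2l.
  by rewrite mulr1 ler_nat.
have ar : a <= r ^+ 3 by rewrite ler_pdivrMr // -exprSr.
(* Compare cubes: [64 * L ^+ 3 = a / 2], while [a <= r ^+ 3] since [s * tanh B <= n]. *)
have Lr : 4 * L <= r.
  rewrite -(@ler_pXn2r _ 3) ?nnegrE ?(ltW r0) ?mulr_ge0 ?(ltW L0) //.
  rewrite exprMn L3; lra.
(* The moment bound at [lam = r ^- 3] and [C = 1], where the exponent [C * (2 * C + 10)] equals 12;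
   on the rejection event the tilt is at least [1 + L]. *)
have null : cw_prob 1 (0 : 'rV[R]_n) (fun x => L <= r * sample_mean x) <= 2 * expR 12 / L.
  have := @cw_exp_moment R n 1 r (r ^+ 3)^-1 ler01 n0 r0 rn.
  rewrite mulVf ?lt0r_neq0 // invr_ge0 (ltW r30) lexx => /(_ erefl erefl).
  have -> : (1 * (2 * 1 + 10) : R) = 12 by ring.
  move=> mom; rewrite ler_pdivlMr //; apply: le_trans mom.
  rewrite /cw_prob mulr_suml [leRHS](bigID (fun x : config n => L <= r * sample_mean x)) /=.
  apply: ler_wpDr.
    by apply: sumr_ge0 => x _; rewrite mulr_ge0 ?cw_pmf_ge0 ?expR_ge0.
  apply: ler_sum => x; rewrite testE => Lx; rewrite ler_wpM2l ?cw_pmf_ge0 //.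
  apply: le_trans (expR_ge1Dx _).
  have : L <= (r ^+ 3)^-1 * \sum_(i < n) spin x i by rewrite ler_pdivlMl // mulrC.
  lra.
rewrite /risk mulrDl lerD //.
have [[p [mu0 h0 hp]]|/set0P/negP/negPn/eqP ->] := pselect
    ([set cw_prob 1 mu (fun x : config n => ~~ (L <= r * sample_mean x)) | mu in Xi s B] !=set0);
  last by rewrite sup0 divr_ge0 // ltW.
apply: ge_sup; first by exists p, mu0.
move=> _ [mu [smu mB] <-].
have mu_ge0 i : 0 <= mu 0 i.
  have [/mB|] := boolP (i \in supp mu); first by apply: le_trans; exact: ltW.
  by rewrite inE negbK => /eqP ->.
have := @cw_lower_tail R n mu s (tanh B) r L n0 r0 rn t0 t1 mu_ge0 (esym smu)
  (fun i hi => tanh_expR (mB i hi)) L4 Lr.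
rewrite -/a L3 => H.
have -> : cw_prob 1 mu (fun x => ~~ (L <= r * sample_mean x)) =
    cw_prob 1 mu (fun x => \sum_(i < n) spin x i < L * r ^+ 3).
  by apply: eq_bigl => x; rewrite testE ltNge.
set q := cw_prob _ _ _ in H *.
have q0 : 0 <= q by exact: cw_prob_ge0.
have E : s%:R * tanh B * L / (8 * r) = a * L / 8.
  by rewrite /a; field; exact: lt0r_neq0.
rewrite E in H.
have {}H : (1 + a * L / 8) * q <= 1 by apply: H; lra.
rewrite ler_pdivlMr // mulrC; apply: le_trans H.
rewrite ler_wpM2r //.
have : 16 * L <= a * L by rewrite ler_wpM2r // ltW.
lra.
Qed.

Lemma limn_sup_ge (u : nat -> R) (c : R) : (forall n, 0 <= u n <= 2) ->
  (\forall n \near \oo, c <= u n) -> c <= limn_sup u.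
Proof.
move=> u02 [N _ cu].
have bu : bounded_fun (u : nat -> R^o).
  exists 2; split; first exact: num_real.
  move=> M M2 n _ /=; have /andP[u0 u2] := u02 n.
  by rewrite ger0_norm // (le_trans u2) // ltW.
rewrite limn_supE //; apply: lb_le_inf; first by exists (sups u 0), 0%N.
move=> _ [n _ <-]; apply: (@le_trans _ _ (u (maxn n N))).
  by apply: cu; exact: leq_maxr.
apply: ub_le_sup; last by exists (maxn n N) => //=; exact: leq_maxl.
by exists 2 => _ [k _ <-]; case/andP: (u02 k).
Qed.

End Asymptotics.

(** * The two sides of the threshold n ^ (1/4) *)

Theorem theorem3 (R : realType) (s : nat -> nat) (B : nat -> R)
    (hs : forall n : nat, (0 < n)%N -> (1 <= s n <= n)%N)
    (hB : forall n : nat, (0 < n)%N -> 0 < B n) :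
  ((fun n : nat => n%:R `^ 4^-1 : R) =o_\oo
     (fun n : nat => (s n)%:R * tanh (B n) : R) ->
   exists L : nat -> R,
     L n @[n --> \oo] --> +oo%R /\
     asymptotically_powerful 1 s B
       (fun (n : nat) (x : config n) => L n <= n%:R `^ 4^-1 * sample_mean x))
  /\
  ((fun n : nat => (s n)%:R * tanh (B n) : R) =O_\oo
     (fun n : nat => n%:R `^ 4^-1 : R) ->
   ~ exists T : forall n : nat, config n -> bool,
       asymptotically_powerful 1 s B T).
Proof.
split.
- move=> /eqoP so.
  pose r (n : nat) : R := n%:R `^ 4^-1.
  pose a n := (s n)%:R * tanh (B n) / r n.
  have a_large (A : R) : 0 < A -> \forall n \near \oo, (0 < n)%N /\ A <= a n.
    move=> A0; have iA0 : 0 < A^-1 by rewrite invr_gt0.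
    near=> n.
    have n0 : (0 < n)%N by near: n; exists 1%N.
    split => //; rewrite /a ler_pdivlMr ?fourth_root_gt0 //.
    have : `|r n| <= A^-1 * `|(s n)%:R * tanh (B n)| by near: n; exact: so.
    rewrite ger0_norm ?powR_ge0 // ger0_norm; last first.
      by rewrite mulr_ge0 // tanh_ge0 // ltW // hB.
    by rewrite ler_pdivlMl.
  (* The level prescribed by [risk_magnetization_test_le]; it diverges together with [a]. *)
  pose L n := (a n / 128) `^ 3^-1.
  have L_large (A : R) : 0 < A -> \forall n \near \oo,
      [/\ (0 < n)%N, 16 <= a n, L n ^+ 3 = a n / 128 & A <= L n].
    move=> A0; have A3 : 0 < A ^+ 3 by rewrite exprn_gt0.
    have C0 : 0 < 128 * A ^+ 3 + 16 by lra.
    near=> n.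
    have [n0 An] : (0 < n)%N /\ 128 * A ^+ 3 + 16 <= a n by near: n; exact: a_large.
    have LX : L n ^+ 3 = a n / 128 by rewrite cube_rootX //; lra.
    split => //; first lra.
    rewrite -(@ler_pXn2r _ 3) ?nnegrE ?powR_ge0 ?(ltW A0) // LX; lra.
  exists L; split.
    apply/cvgryPge => A; near=> n.
    have [_ _ _ AL] : [/\ (0 < n)%N, 16 <= a n, L n ^+ 3 = a n / 128 & `|A| + 1 <= L n].
      by near: n; apply: L_large; have := normr_ge0 A; lra.
    by apply: le_trans AL; have := ler_norm A; lra.
  rewrite /asymptotically_powerful.
  set u := fun n => risk _ _ _ _.
  have : u @ \oo --> (0 : R^o).
    apply/cvgr0Pnorm_le => e e0.
    have K0 := expR_gt0 (12 : R).
    (* Above this level the first summand brings the risk bound below [e], and the second supplies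
       [4 <= L n]. *)
    have D0 : 0 < (2 * expR 12 + 1) / e + 4 by rewrite addr_gt0 // divr_gt0 //; lra.
    near=> n.
    have [n0 a16 LX eL] : [/\ (0 < n)%N, 16 <= a n, L n ^+ 3 = a n / 128 &
        (2 * expR 12 + 1) / e + 4 <= L n] by near: n; exact: L_large.
    have L0 : 0 < L n by lra.
    have /andP[_ sn] := hs n n0.
    have [u0 _ _ _] := @risk_bounds R n (s n) (B n)
      (fun x => L n <= n%:R `^ 4^-1 * sample_mean x).
    rewrite /u ger0_norm //.
    apply: le_trans (risk_magnetization_test_le n0 sn (hB n n0) _ LX a16) _.
      have : 0 <= (2 * expR 12 + 1) / e by rewrite divr_ge0 ?(ltW e0) //; lra.
      lra.
    by rewrite ler_pdivrMr // [leRHS]mulrC -ler_pdivrMr //; lra.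
  by move=> /cvg_limn_inf_sup[_ ->].
- move=> /eqO_exP[k k0 sO] [T Tpow].
  (* The bound of [cw_exp_moment] at [C = 2 * k]: squaring the likelihood ratio bound doubles its
     exponent. The risk then stays eventually above [(4 * K)^-1]. *)
  pose K : R := 2 * expR (2 * k * (2 * (2 * k) + 10)).
  have K1 : 1 <= K.
    have : 1 <= expR (2 * k * (2 * (2 * k) + 10)).
      by rewrite -[leLHS]expR0 ler_expR; nra.
    by rewrite /K; lra.
  have : (4 * K)^-1 <= limn_sup (fun n => risk 1 (s n) (B n) (T n)).
    apply: limn_sup_ge => [n|].
      by have [-> _ -> _] := @risk_bounds R n (s n) (B n) (T n).
    near=> n.
    have n0 : (0 < n)%N by near: n; exists 1%N.
    have /andP[_ sn] := hs n n0.
    have r0 := @fourth_root_gt0 R n n0; have rn := @fourth_rootX R n.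
    have : `|(s n)%:R * tanh (B n)| <= k * `|n%:R `^ 4^-1| by near: n; exact: sO.
    have t0 := tanh_ge0 (ltW (hB n n0)).
    rewrite ger0_norm; last by rewrite mulr_ge0.
    rewrite gtr0_norm // => st.
    move: (n%:R `^ 4^-1) r0 rn st => r r0 rn st.
    rewrite -div1r ler_pdivrMr; last lra.
    rewrite mulrC; apply: risk_lower_bound => //; first exact: hB.
    apply: (@cw_exp_moment R n (2 * k) r) => //.
    + lra.
    + by rewrite mulr_ge0 // divr_ge0 // mulr_ge0.
    + have -> : 2 * ((s n)%:R * tanh (B n) / n%:R) * r ^+ 3 =
          2 * ((s n)%:R * tanh (B n) / r).
        by rewrite -rn; field; exact: lt0r_neq0.
      by rewrite ler_wpM2l // ler_pdivrMr.
  rewrite Tpow leNgt invr_gt0; lra.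
Unshelve. all: by end_near. Qed.
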